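(* Let $T\ge1$ be an integer, $0<\epsilon<1$, $\kappa=1-\epsilon^2$, and let $\bar v$ be the value function and $\bar u$ the ($C^0$) function defined in the context, with parameters $$\sigma=2\epsilon\Big/\log\Big(\frac{1+\epsilon}{1-\epsilon}\Big),\qquad b=\frac1\epsilon .$$ Then $$|\bar u(\epsilon T,0,-T)-\bar v(\epsilon T,0,-T)|\le\bar E_0(-T),$$ where the error term $\bar E_0(-T)$ is $O\big((1+\frac1\sigma)\sqrt\kappa\big)$. When $\epsilon\to0$, $\bar E_0(-T)$ is $O(1)$.
   Context: $O(\cdot)$ is understood with an absolute constant, independent of $T\ge1$ and $\epsilon\in(0,1)$; ''when $\epsilon\to0$, $O(1)$'' means bounded by an absolute constant for all sufficiently small $\epsilon$ and all $T\ge1$. Value function $\bar v$ (final-time pseudoregret of the symmetric two-armed Bernoulli bandit with centered rewards, under the myopic player, started at time $t$ with given $\xi^r$ and number $s_2$ of pulls of the risky arm 2): $\bar v(\xi^r,s_2,0)=2\epsilon s_2$ and, for integers $t\le-1$, $$\bar v(\xi^r,s_2,t)=\mathbb E\big[\bar v(\xi^r+d\xi^r,s_2+ds_2,t+1)\big].$$ Here $g_1,g_2\in\{-1,1\}$ are independent with $P(g_1=1)=\frac{1+\epsilon}2$ and $P(g_2=1)=\frac{1-\epsilon}2$; $I\in\{1,2\}$ is independent of $(g_1,g_2)$ and sampled from $p^m(\xi^r,t)$, which equals $(1,0)$ if $\xi^r+\epsilon t>0$, $(\frac12,\frac12)$ if $\xi^r+\epsilon t=0$, $(0,1)$ if $\xi^r+\epsilon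 t<0$; and $d\xi^r=g_1\mathbf 1_{\{I=1\}}-g_2\mathbf 1_{\{I=2\}}-\epsilon$, $ds_2=\mathbf 1_{\{I=2\}}$. The domain of $\bar v$ is restricted to integer values of $\xi^r+\epsilon t$ and $s_2$. Function $\bar u$: for $t<0$ and parameters $\sigma,b>0$, $$\bar u(\xi^r,s_2,t)=2\epsilon s_2+\bar\varphi(\xi^r+\epsilon t)-\int_{\mathbb R}\Phi(\xi^r-s,t)\bar\varphi(s)\,ds,\qquad \Phi(s,t)=\frac1{\sqrt{-2\pi\kappa t}}\exp\Big(\frac{s^2}{2\kappa t}\Big),$$ with $\bar\varphi(y)=-2y$ for $y\le0$ and $\bar\varphi(y)=b e^{-2\epsilon y/\sigma}-b$ for $y>0$. (Here $\Phi$ uses $\kappa$, while $\bar\varphi$ uses $\sigma$.) *)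

(* Defs.v *)
From HB Require Import structures.
From mathcomp Require Import all_boot all_order all_algebra.
From mathcomp Require Import all_classical all_reals all_analysis.

Set Implicit Arguments.
Unset Strict Implicit.
Unset Printing Implicit Defensive.

Import Order.TTheory GRing.Theory Num.Theory.
Import numFieldNormedType.Exports.

Local Open Scope ring_scope.

(* Rewards are coded by booleans: true is the reward 1, false the reward -1. *)
Definition reward (R : realType) (g : bool) : R := if g then 1 else -1.

(* Law of a {-1, 1}-valued reward with mean m. *)
Definition reward_law (R : realType) (m : R) (g : bool) : R :=
  if g then (1 + m) / 2 else (1 - m) / 2.

(* The myopic player p^m(xi, t) as a law on the arms; an arm is coded by a
   boolean: false is the safe arm 1, true is the risky arm 2. *)
Definition myopic (R : realType) (eps xi t : R) (I : bool) : R :=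
  let y := xi + eps * t in
  if 0 < y then (if I then 0 else 1)
  else if y == 0 then 1 / 2
  else (if I then 1 else 0).

(* E[f(g1, g2, I)], where g1, g2 and I are independent, g1 has mean eps, g2 has
   mean -eps and I is sampled from myopic eps xi t. *)
Definition expect_round (R : realType) (eps xi t : R)
    (f : bool -> bool -> bool -> R) : R :=
  \sum_(g1 : bool) \sum_(g2 : bool) \sum_(I : bool)
    reward_law eps g1 * reward_law (- eps) g2 * myopic eps xi t I * f g1 g2 I.

Definition dxi (R : realType) (eps : R) (g1 g2 I : bool) : R :=
  (if I then - reward R g2 else reward R g1) - eps.

Definition ds2 (I : bool) : int := if I then 1 else 0.

(* The value function with n rounds to go, that is at time t = - n. *)
Fixpoint vbar_togo (R : realType) (eps : R) (n : nat) (xi : R) (s2 : int) : R :=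
  match n with
  | 0%N => 2 * eps * s2%:~R
  | m.+1 => expect_round eps xi (- m.+1%:R)
              (fun g1 g2 I => vbar_togo eps m (xi + dxi eps g1 g2 I) (s2 + ds2 I))
  end.

(* Meaningful for t <= 0 only. The restriction of the domain to integer values
   of xi + eps * t is not encoded: it is preserved by the recursion, as
   xi + eps * t moves by 1 or -1 at every round. *)
Definition vbar (R : realType) (eps xi : R) (s2 t : int) : R :=
  vbar_togo eps `|t|%N xi s2.

Definition phibar (R : realType) (eps sigma b y : R) : R :=
  if y <= 0 then - 2 * y else b * expR (- 2 * eps * y / sigma) - b.

Definition Phi (R : realType) (kappa s t : R) : R :=
  1 / Num.sqrt (- 2 * pi * kappa * t) * expR (s ^+ 2 / (2 * kappa * t)).

Definition ubar (R : realType) (eps kappa sigma b xi s2 t : R) : R :=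
  2 * eps * s2 + phibar eps sigma b (xi + eps * t)
  - \int[@lebesgue_measure R]_s (Phi kappa (xi - s) t * phibar eps sigma b s).

(* Main.v *)
(* Whichever arm is pulled, y = xi + eps t moves by 1 with probability
   (1 + eps) / 2 and by -1 otherwise, and phibar solves the Poisson equation of
   this walk Y. Hence vbar(eps T, 0, -T) = - E phibar(Y_T), to be compared with
   ubar(eps T, 0, -T) = - E phibar(Z), where Z is Gaussian of mean eps T and
   variance kappa T. If eps < 1/2 and T <= exp(3 / eps), the increments of Y are
   replaced one at a time by Gaussian ones: as phibar is Lipschitz, replacing an
   increment when k others are already Gaussian costs O(k^(-3/2) + eps / k), the
   third moment of the increments being O(eps), and the sum over k is O(1). In
   the other regimes both expectations are close to -b: with
   theta = log((1 + eps) / (1 - eps)), phibar + b lies between 0 and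
   4 b exp(- theta y / 2), and E exp(- theta Y_T / 2) = kappa^(T/2). *)

Require Import Defs.
From HB Require Import structures.
From mathcomp Require Import all_boot all_order all_algebra.
From mathcomp Require Import all_classical all_reals all_analysis.
From mathcomp Require Import measurable_realfun ring lra.

Set Implicit Arguments.
Unset Strict Implicit.
Unset Printing Implicit Defensive.

Import Order.TTheory GRing.Theory Num.Theory.
Import numFieldNormedType.Exports.

Local Open Scope classical_set_scope.
Local Open Scope ring_scope.

(** * Gaussian kernel: derivatives, pointwise bounds, replacement of one increment *)

Section gauss_kernel.
Context {R : realType}.
Implicit Types v w x t : R.

(** Density of the centered Gaussian of variance [v]; the variance is an argument because it is
    differentiated along an interpolation. *)
Definition gauss v x : R :=
  expR (- (x ^+ 2 / (2 * v))) / (Num.sqrt (2 * pi) * Num.sqrt v).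

Definition dgauss1 v x : R := - (x / v) * gauss v x.
Definition dgauss2 v x : R := (x ^+ 2 / v ^+ 2 - v^-1) * gauss v x.
Definition dgauss3 v x : R := (3 * x / v ^+ 2 - x ^+ 3 / v ^+ 3) * gauss v x.
Definition dgauss4 v x : R :=
  (x ^+ 4 / v ^+ 4 - 6 * x ^+ 2 / v ^+ 3 + 3 / v ^+ 2) * gauss v x.

Lemma sqrt2pi_gt0 : 0 < Num.sqrt (2 * pi) :> R.
Proof. by rewrite sqrtr_gt0 mulr_gt0 ?pi_gt0. Qed.

Lemma gauss_ge0 v x : 0 <= gauss v x.
Proof. by rewrite /gauss divr_ge0 ?expR_ge0 ?mulr_ge0 ?sqrtr_ge0. Qed.

Lemma is_derive_sqrt_comp (f : R -> R) t df : 0 < f t ->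
  is_derive t 1 f df ->
  is_derive t 1 (fun y => Num.sqrt (f y)) ((2 * Num.sqrt (f t))^-1 * df).
Proof.
move=> ft hf; apply: (@is_derive1_comp _ Num.sqrt f) => //.
exact: is_derive1_sqrt.
Qed.

(** The heat equation: the derivative in the variance is half the second derivative in space, hence
    the coefficient [2^-1 * dgauss2] of [dV]. *)
Lemma is_derive_gauss (V X : R -> R) t dV dX : 0 < V t ->
  is_derive t 1 V dV -> is_derive t 1 X dX ->
  is_derive t 1 (fun y => gauss (V y) (X y))
    (dgauss1 (V t) (X t) * dX + 2^-1 * dgauss2 (V t) (X t) * dV).
Proof.
move=> V0 hV hX; pose c := (Num.sqrt (2 * pi) : R)^-1.
have s0 : 0 < Num.sqrt (V t) by rewrite sqrtr_gt0.
have hE : is_derive t 1 (fun y => - (X y ^+ 2 / (2 * V y)))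
    (- (X t * dX / V t) + X t ^+ 2 * dV / (2 * V t ^+ 2)).
  have h2V : is_derive t 1 (fun y => (2 * V y)^-1)
      (- (2 * V t) ^- 2 *: (2 *: dV)).
    by apply: is_deriveV; rewrite ?mulf_neq0 ?gt_eqF//;
      apply: is_deriveZ.
  apply: is_derive_eq; rewrite /GRing.scale/=; field.
  by rewrite gt_eqF.
have hS : is_derive t 1 (fun y => (Num.sqrt (V y))^-1)
   (- (Num.sqrt (V t)) ^- 2 *: ((2 * Num.sqrt (V t))^-1 * dV)).
  by apply: is_deriveV; rewrite ?gt_eqF//; exact: is_derive_sqrt_comp.
rewrite (_ : (fun y => gauss (V y) (X y)) =
  (fun y => c * (expR (- (X y ^+ 2 / (2 * V y))) * (Num.sqrt (V y))^-1)));
  last first.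
  by apply/funext => y; rewrite /gauss /c; set e := expR _; rewrite invfM; ring.
apply: is_derive_eq.
rewrite /GRing.scale/= /dgauss1 /dgauss2 /gauss.
have sV : V t = Num.sqrt (V t) ^+ 2 by rewrite sqr_sqrtr ?ltW.
set e := expR _; move: s0 sV; set s := Num.sqrt (V t) => s0 ->.
by rewrite /c; field; rewrite ?gt_eqF ?sqrt2pi_gt0.
Qed.

Lemma is_derive_mul_gauss v x (P : R -> R) dP : 0 < v ->
  is_derive x 1 P dP ->
  is_derive x 1 (fun y => P y * gauss v y) ((dP - x / v * P x) * gauss v x).
Proof.
move=> v0 hP.
have hg : is_derive x 1 (gauss v) (dgauss1 v x).
  apply: (is_derive_eq (@is_derive_gauss (cst v) id x 0 1 v0 _ _)).
  by rewrite /=; ring.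
apply: is_derive_eq.
by rewrite /GRing.scale/= /dgauss1; ring.
Qed.

Lemma is_derive_dgauss1 v x : 0 < v ->
  is_derive x 1 (dgauss1 v) (dgauss2 v x).
Proof.
move=> v0; apply: (is_derive_eq (@is_derive_mul_gauss v x
  (fun y => - (y / v)) _ v0 _)).
by rewrite /GRing.scale/= /dgauss2; field; rewrite gt_eqF.
Qed.

Lemma is_derive_dgauss2 v x : 0 < v ->
  is_derive x 1 (dgauss2 v) (dgauss3 v x).
Proof.
move=> v0; apply: (is_derive_eq (@is_derive_mul_gauss v x
  (fun y => y ^+ 2 / v ^+ 2 - v^-1) _ v0 _)).
by rewrite /GRing.scale/= /dgauss3; field; rewrite gt_eqF.
Qed.

Lemma is_derive_dgauss3 v x : 0 < v ->
  is_derive x 1 (dgauss3 v) (dgauss4 v x).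
Proof.
move=> v0; apply: (is_derive_eq (@is_derive_mul_gauss v x
  (fun y => 3 * y / v ^+ 2 - y ^+ 3 / v ^+ 3) _ v0 _)).
by rewrite /GRing.scale/= /dgauss4; field; rewrite gt_eqF.
Qed.


Lemma ler_normB_MVT (f df : R -> R) (a b M : R) : a <= b ->
  (forall x, a <= x <= b -> is_derive x 1 f (df x)) ->
  (forall x, a <= x <= b -> `|df x| <= M) ->
  `|f b - f a| <= M * (b - a).
Proof.
move=> ab hf hM.
have [||c] := @MVT_segment R f df a b ab.
- by move=> x; rewrite in_itv/= => /andP[ax xb]; apply: hf; rewrite !ltW.
- apply: derivable_within_continuous => x; rewrite in_itv/= => xab.
  exact: (@ex_derive _ _ _ _ _ _ _ (hf x xab)).
rewrite in_itv/= => cab ->.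
by rewrite normrM (ger0_norm (_ : 0 <= b - a)) ?subr_ge0// ler_wpM2r ?subr_ge0 ?hM.
Qed.

(** Half of the exponent is traded for a doubled variance, which leaves a factor
    [expR (x ^+ 2 / (4 * v))] to absorb polynomials; the normalisation changes by sqrt 2 only. *)
Lemma gauss_le_double v x : 0 < v ->
  expR (x ^+ 2 / (4 * v)) * gauss v x <= 2 * gauss (2 * v) x.
Proof.
move=> v0; have sv : 0 < Num.sqrt v by rewrite sqrtr_gt0.
have s2 : 0 < Num.sqrt (2 : R) by rewrite sqrtr_gt0.
have -> : expR (x ^+ 2 / (4 * v)) * gauss v x =
    Num.sqrt 2 * gauss (2 * v) x.
  rewrite /gauss (sqrtrM v)//.
  have -> : - (x ^+ 2 / (2 * v)) = - (x ^+ 2 / (2 * (2 * v))) - x ^+ 2 / (4 * v).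
    by field; rewrite gt_eqF.
  rewrite expRB; field.
  by rewrite !gt_eqF ?sqrt2pi_gt0 ?expR_gt0.
rewrite ler_wpM2r ?gauss_ge0// -[leRHS](@ger0_norm R) // -sqrtr_sqr.
by rewrite ler_wsqrtr// expr2; lra.
Qed.

Lemma norm_poly_gauss_le v x (A c : R) : 0 < v ->
  A <= c * expR (x ^+ 2 / (4 * v)) -> 0 <= c ->
  A * gauss v x <= 2 * c * gauss (2 * v) x.
Proof.
move=> v0 hA c0; apply: (le_trans (ler_wpM2r (gauss_ge0 v x) hA)).
rewrite -[leLHS]mulrA (_ : 2 * c * _ = c * (2 * gauss (2 * v) x)); last by ring.
by rewrite ler_wpM2l// gauss_le_double.
Qed.

Lemma norm_dgauss4_le v x : 0 < v ->
  `|dgauss4 v x| <= 112 / v ^+ 2 * gauss (2 * v) x.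
Proof.
move=> v0; rewrite /dgauss4 normrM (ger0_norm (gauss_ge0 _ _)).
have -> : 112 / v ^+ 2 = 2 * (56 / v ^+ 2) by ring.
apply: norm_poly_gauss_le => //; last by rewrite divr_ge0// exprn_ge0// ltW.
(* From y <= e^y and y^2 <= 2 e^y, |16 y^2 - 24 y + 3| <= 56 e^y. *)
set y := x ^+ 2 / (4 * v).
have y0 : 0 <= y by rewrite /y divr_ge0 ?sqr_ge0 ?mulr_ge0// ltW.
have -> : x ^+ 4 / v ^+ 4 - 6 * x ^+ 2 / v ^+ 3 + 3 / v ^+ 2 =
    (16 * y ^+ 2 - 24 * y + 3) / v ^+ 2.
  by rewrite /y; field; rewrite gt_eqF.
have v2 : 0 < (v ^+ 2)^-1 by rewrite invr_gt0 exprn_gt0.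
rewrite normrM (gtr0_norm v2) mulrAC ler_pM2r//.
have e1 := expR_ge1Dx y.
have /= e2 := expR_ge1Dxn 1 y0; rewrite (_ : 2`! = 2)%N// in e2.
have := sqr_ge0 y; rewrite ler_norml => y2.
by apply/andP; split; lra.
Qed.

Lemma norm_dgauss3_le v x : 0 < v ->
  `|dgauss3 v x| <= 48 / (v * Num.sqrt v) * gauss (2 * v) x.
Proof.
move=> v0; rewrite /dgauss3 normrM (ger0_norm (gauss_ge0 _ _)).
have sv : 0 < Num.sqrt v by rewrite sqrtr_gt0.
have -> : 48 / (v * Num.sqrt v) = 2 * (24 / (v * Num.sqrt v)) by ring.
apply: norm_poly_gauss_le => //; last by rewrite divr_ge0// mulr_ge0// ltW.
set y := x ^+ 2 / (4 * v).
have y0 : 0 <= y by rewrite /y divr_ge0 ?sqr_ge0 ?mulr_ge0// ltW.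
pose z := x / Num.sqrt v.
have vE : v = Num.sqrt v ^+ 2 by rewrite sqr_sqrtr ?ltW.
have yE : y = z ^+ 2 / 4.
  by rewrite /y /z {1}vE; field; rewrite gt_eqF.
have -> : 3 * x / v ^+ 2 - x ^+ 3 / v ^+ 3 = (3 * z - z ^+ 3) / (v * Num.sqrt v).
  rewrite /z; move: vE sv; set s := Num.sqrt v => -> sv; field.
  by rewrite gt_eqF.
have v2 : 0 < (v * Num.sqrt v)^-1 by rewrite invr_gt0 mulr_gt0.
rewrite normrM (gtr0_norm v2) mulrAC ler_pM2r//.
have e1 := expR_ge1Dx y.
have /= e2 := expR_ge1Dxn 1 y0; rewrite (_ : 2`! = 2)%N// in e2.
(* The squares give |z| <= (1 + z^2) / 2 and |z|^3 <= (z^2 + z^4) / 2; the even powers are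
   controlled by e^y with y = z^2 / 4. *)
have p1 := sqr_ge0 (z - 1); have p2 := sqr_ge0 (z + 1).
have p3 := sqr_ge0 (z * (z - 1)); have p4 := sqr_ge0 (z * (z + 1)).
rewrite yE in e1 e2 *; rewrite ler_norml.
by apply/andP; split; nra.
Qed.

Lemma norm_mul_gauss_le v x : 0 < v ->
  `|x| * gauss v x <= 4 * Num.sqrt v * gauss (2 * v) x.
Proof.
move=> v0; have sv : 0 < Num.sqrt v by rewrite sqrtr_gt0.
have -> : 4 * Num.sqrt v = 2 * (2 * Num.sqrt v) by ring.
apply: norm_poly_gauss_le => //.
pose z := `|x| / Num.sqrt v.
have vE : v = Num.sqrt v ^+ 2 by rewrite sqr_sqrtr ?ltW.
have -> : x ^+ 2 / (4 * v) = z ^+ 2 / 4.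
  by rewrite /z {1}vE -real_normK ?num_real//; field; rewrite gt_eqF.
have -> : `|x| = z * Num.sqrt v by rewrite /z divfK// gt_eqF.
rewrite [leRHS]mulrAC ler_pM2r//.
have := expR_ge1Dx (z ^+ 2 / 4); nra.
Qed.

(** Dominates every kernel met along the interpolation by a single Gaussian centered at [w]. The
    shift by at most 2 costs e^(1/2) <= 2, because w^2 <= 2 x^2 + 8, and the change of normalisation
    costs at most 3. *)
Lemma gauss_shift_le (N v x w : R) : 1 <= N -> 3 / 4 * N <= v <= 2 * N ->
  `|x - w| <= 2 -> gauss (2 * v) x <= 6 * gauss (8 * N) w.
Proof.
move=> N1 /andP[Nv vN]; rewrite ler_norml => /andP[xw1 xw2].
have N0 : 0 < N by lra.
have v0 : 0 < v by lra.
have s8 : 0 < Num.sqrt (8 * N) by rewrite sqrtr_gt0; lra.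
have s2 : 0 < Num.sqrt (2 * v) by rewrite sqrtr_gt0; lra.
rewrite /gauss.
have -> : 6 * (expR (- (w ^+ 2 / (2 * (8 * N)))) /
    (Num.sqrt (2 * pi) * Num.sqrt (8 * N))) =
    (2 * expR (- (w ^+ 2 / (2 * (8 * N))))) *
    (3 / (Num.sqrt (2 * pi) * Num.sqrt (8 * N))) by ring.
apply: ler_pM; rewrite ?expR_ge0 ?invr_ge0 ?mulr_ge0 ?sqrtr_ge0//.
  have e2 : expR (2^-1 : R) <= 2.
    have := expR_ge1Dx (- (2^-1) : R); rewrite expRN => h.
    have e0 := expR_gt0 (2^-1 : R).
    have : 2^-1 <= (expR (2^-1 : R))^-1 by lra.
    by rewrite lef_pV2// posrE.
  apply: (@le_trans _ _ (expR (2^-1 - w ^+ 2 / (2 * (8 * N))))); last first.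
    by rewrite expRD ler_wpM2r// expR_ge0.
  rewrite ler_expR.
  have h1 : x ^+ 2 / (2 * (4 * N)) <= x ^+ 2 / (2 * (2 * v)).
    by rewrite ler_wpM2l ?sqr_ge0// lef_pV2 ?posrE; lra.
  have h2 : w ^+ 2 / (2 * (8 * N)) <= x ^+ 2 / (2 * (4 * N)) + 2^-1.
    rewrite -subr_ge0.
    have -> : x ^+ 2 / (2 * (4 * N)) + 2^-1 - w ^+ 2 / (2 * (8 * N)) =
       (2 * x ^+ 2 + 8 * N - w ^+ 2) / (16 * N) by field; rewrite gt_eqF.
    rewrite divr_ge0//; last by lra.
    have := sqr_ge0 (2 * x - w); nra.
  by lra.
rewrite ler_pdivlMr ?mulr_gt0 ?sqrt2pi_gt0//.
rewrite mulrC ler_pdivrMr ?mulr_gt0 ?sqrt2pi_gt0//.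
rewrite mulrCA ler_pM2l ?sqrt2pi_gt0//.
have -> : (3 : R) = Num.sqrt (3 ^+ 2) by rewrite sqrtr_sqr ger0_norm.
rewrite -sqrtrM ?sqr_ge0// ler_wsqrtr//; nra.
Qed.

(** Error of the trapezoid rule for [dgauss2] on [m - h, m + h]. It vanishes at h = 0 and its
    derivative in h is - h / 2 times a difference of third derivatives, so two mean value
    inequalities leave a fourth derivative. *)
Lemma trapezoid_dgauss1_le v m h M : 0 < v -> 0 <= h <= 1 ->
  (forall x, `|x - m| <= 1 -> `|dgauss4 v x| <= M) ->
  `|2^-1 * (dgauss1 v (m + h) - dgauss1 v (m - h))
    - h / 2 * (dgauss2 v (m + h) + dgauss2 v (m - h))| <= M.
Proof.
move=> v0 /andP[h0 h1] hM.
have M0 : 0 <= M by rewrite (le_trans (normr_ge0 _) (hM m _))// subrr normr0.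
pose B t : R := 2^-1 * (dgauss1 v (m + t) - dgauss1 v (m - t))
    - t / 2 * (dgauss2 v (m + t) + dgauss2 v (m - t)).
pose dB t : R := - (t / 2 * (dgauss3 v (m + t) - dgauss3 v (m - t))).
have hp (t : R) : is_derive t 1 (fun y => m + y) 1.
  by apply: is_derive_eq; ring.
have hm (t : R) : is_derive t 1 (fun y => m - y) (-1).
  by apply: is_derive_eq; ring.
have compp (F dF : R -> R) t : (forall x, is_derive x 1 F (dF x)) ->
    is_derive t 1 (fun y => F (m + y)) (dF (m + t) * 1).
  by move=> hF; apply: (@is_derive1_comp _ F (fun y => m + y)).
have compm (F dF : R -> R) t : (forall x, is_derive x 1 F (dF x)) ->
    is_derive t 1 (fun y => F (m - y)) (dF (m - t) * -1).
  by move=> hF; apply: (@is_derive1_comp _ F (fun y => m - y)).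
have d1p t := compp _ _ t (fun x => is_derive_dgauss1 x v0).
have d1m t := compm _ _ t (fun x => is_derive_dgauss1 x v0).
have d2p t := compp _ _ t (fun x => is_derive_dgauss2 x v0).
have d2m t := compm _ _ t (fun x => is_derive_dgauss2 x v0).
have dBE t : is_derive t 1 B (dB t).
  apply: is_derive_eq.
  by rewrite /GRing.scale/= /dB; field.
have BE : B h - B 0 = B h by rewrite /B addr0 subr0; field.
change (`|B h| <= M); rewrite -BE.
apply: (le_trans (@ler_normB_MVT B dB 0 h M _ _ _)) => //; last first.
  by rewrite subr0 ler_piMr.
move=> t /andP[t0 th]; rewrite /dB normrN normrM ger0_norm ?divr_ge0//.
have tt : m - t <= m + t by lra.
have : `|dgauss3 v (m + t) - dgauss3 v (m - t)| <= M * (m + t - (m - t)).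
  apply: (@ler_normB_MVT _ (dgauss4 v)) => // x xmt.
    exact: is_derive_dgauss3.
  by apply: hM; rewrite ler_norml; lra.
rewrite (_ : m + t - (m - t) = 2 * t); last by ring.
set D := `|_| => hD.
apply: (@le_trans _ _ (t / 2 * (M * (2 * t)))).
  by rewrite ler_wpM2l// divr_ge0.
rewrite (_ : t / 2 * (M * (2 * t)) = M * t ^+ 2); last by field.
by rewrite ler_piMr// expr_le1//; lra.
Qed.

(* Interpolates along N(w, kappa (N + 1 - t^2)) + t X, where X is the centered
   two-point increment of variance kappa, so that the variance stays constant. *)
Lemma gauss_two_point_le (N eps kappa w : R) : 1 <= N -> 0 < eps < 2^-1 ->
  kappa = 1 - eps ^+ 2 ->
  `|(1 + eps) / 2 * gauss (kappa * N) (w + (1 - eps))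
   + (1 - eps) / 2 * gauss (kappa * N) (w - (1 + eps))
   - gauss (kappa * (N + 1)) w| <=
  1200 * (1 / N ^+ 2 + eps / (N * Num.sqrt N)) * gauss (8 * N) w.
Proof.
move=> N1 /andP[e0 e1] kE.
have k34 : 3 / 4 <= kappa by rewrite kE; nra.
have k1 : kappa <= 1 by rewrite kE; nra.
have N0 : 0 < N by lra.
pose V t : R := kappa * (N + 1 - t ^+ 2).
pose G t : R := (1 + eps) / 2 * gauss (V t) (w + t * (1 - eps))
  + (1 - eps) / 2 * gauss (V t) (w - t * (1 + eps)).
(* The two atoms sit at [m t + t] and [m t - t]. By the heat equation, [dG] is a trapezoid error, of
   fourth order, plus a term with the factor [eps], due to skewness, of third order. *)
pose m t := w - t * eps.
pose dG t : R := kappa * (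
  (2^-1 * (dgauss1 (V t) (m t + t) - dgauss1 (V t) (m t - t))
    - t / 2 * (dgauss2 (V t) (m t + t) + dgauss2 (V t) (m t - t)))
  - eps * t / 2 * (dgauss2 (V t) (m t + t) - dgauss2 (V t) (m t - t))).
have -> : (1 + eps) / 2 * gauss (kappa * N) (w + (1 - eps))
   + (1 - eps) / 2 * gauss (kappa * N) (w - (1 + eps))
   - gauss (kappa * (N + 1)) w = G 1 - G 0.
  rewrite /G /V !mul1r !mul0r addr0 subr0 expr1n expr0n/= subr0 addrK.
  by field.
have VN t : 0 <= t <= 1 -> 3 / 4 * N <= V t <= 2 * N.
  move=> /andP[t0 t1]; rewrite /V; have t2 : 0 <= t ^+ 2 <= 1 by nra.
  by apply/andP; split; nra.
set g := gauss (8 * N) w.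
have g0 : 0 <= g := gauss_ge0 _ _.
(* The constants come from 112 * 6 / (3/4)^2 <= 1200 and 48 * 6 / (3/4 * 6/7) <= 450, where 6/7 <=
   sqrt (3/4). *)
pose M4 := 1200 / N ^+ 2 * g.
pose M3 := 450 / (N * Num.sqrt N) * g.
have sN : 0 < Num.sqrt N by rewrite sqrtr_gt0.
have M30 : 0 <= M3 by rewrite mulr_ge0 ?divr_ge0 ?mulr_ge0// ltW.
have hM4 t x : 0 <= t <= 1 -> `|x - w| <= 2 -> `|dgauss4 (V t) x| <= M4.
  move=> /VN /andP[V1 V2] xw; have V0 : 0 < V t by lra.
  apply: (le_trans (norm_dgauss4_le _ V0)).
  have V12 : 3 / 4 * N <= V t <= 2 * N by rewrite V1 V2.
  apply: (@le_trans _ _ (112 / V t ^+ 2 * (6 * g))).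
    apply: ler_wpM2l; last exact: gauss_shift_le.
    by rewrite divr_ge0// exprn_ge0// ltW.
  rewrite mulrA /M4 ler_wpM2r// -mulrAC ler_pdivrMr ?exprn_gt0//.
  rewrite mulrAC ler_pdivlMr ?exprn_gt0//.
  have : (3 / 4 * N) ^+ 2 <= V t ^+ 2 by rewrite ler_sqr ?nnegrE; lra.
  nra.
have hM3 t x : 0 <= t <= 1 -> `|x - w| <= 2 -> `|dgauss3 (V t) x| <= M3.
  move=> /VN /andP[V1 V2] xw; have V0 : 0 < V t by lra.
  apply: (le_trans (norm_dgauss3_le _ V0)).
  have V12 : 3 / 4 * N <= V t <= 2 * N by rewrite V1 V2.
  have sV : 0 < Num.sqrt (V t) by rewrite sqrtr_gt0.
  apply: (@le_trans _ _ (48 / (V t * Num.sqrt (V t)) * (6 * g))).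
    apply: ler_wpM2l; last exact: gauss_shift_le.
    by rewrite divr_ge0// mulr_ge0// ltW.
  rewrite mulrA /M3 ler_wpM2r// -mulrAC ler_pdivrMr; last exact: mulr_gt0.
  rewrite mulrAC ler_pdivlMr ?mulr_gt0//.
  have s34 : 6 / 7 * Num.sqrt N <= Num.sqrt (V t).
    rewrite -[X in X * Num.sqrt N]ger0_norm// -sqrtr_sqr -sqrtrM ?sqr_ge0//.
    by rewrite ler_wsqrtr//; nra.
  have : (3 / 4 * N) * (6 / 7 * Num.sqrt N) <= V t * Num.sqrt (V t).
    by rewrite ler_pM// mulr_ge0// ltW.
  nra.
have dGE t : 0 <= t <= 1 -> is_derive t 1 G (dG t).
  move=> t01; have /VN /andP[V1 V2] := t01; have V0 : 0 < V t by lra.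
  have hV : is_derive t 1 V (- 2 * kappa * t).
    by apply: is_derive_eq; rewrite /GRing.scale/=; ring.
  have hp : is_derive t 1 (fun y => w + y * (1 - eps)) (1 - eps).
    by apply: is_derive_eq; rewrite /GRing.scale/=; ring.
  have hm : is_derive t 1 (fun y => w - y * (1 + eps)) (- (1 + eps)).
    by apply: is_derive_eq; rewrite /GRing.scale/=; ring.
  have gp := is_derive_gauss V0 hV hp; have gm := is_derive_gauss V0 hV hm.
  apply: is_derive_eq; rewrite /GRing.scale/= /dG.
  have -> : m t + t = w + t * (1 - eps) by rewrite /m; ring.
  have -> : m t - t = w - t * (1 + eps) by rewrite /m; ring.
  by rewrite kE; field.
have -> : 1200 * (1 / N ^+ 2 + eps / (N * Num.sqrt N)) * g =
  (M4 + eps * (1200 / (N * Num.sqrt N) * g)) * (1 - 0).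
  by rewrite /M4; field; rewrite !gt_eqF.
apply: (le_trans (@ler_normB_MVT G dG 0 1 (M4 + eps * M3) _ _ _)) => //.
  move=> t /[dup] t01 /andP[t0 t1].
  have /VN /andP[V1 V2] := t01; have V0 : 0 < V t by lra.
  rewrite /dG normrM ger0_norm; last by lra.
  set A := 2^-1 * _ - _; set D := dgauss2 _ _ - dgauss2 _ _.
  have hA : `|A| <= M4.
    apply: trapezoid_dgauss1_le => // x; rewrite /m ler_norml => xm.
    apply: hM4 => //; rewrite ler_norml; nra.
  have mt : m t - t <= m t + t by lra.
  have hD : `|D| <= M3 * (m t + t - (m t - t)).
    apply: (@ler_normB_MVT _ (dgauss3 (V t))) => // x; rewrite /m => xm.
      exact: is_derive_dgauss2.
    by apply: hM3 => //; rewrite ler_norml; nra.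
  have hD' : `|eps * t / 2 * D| <= eps * M3.
    rewrite normrM ger0_norm; last by rewrite divr_ge0// mulr_ge0// ltW.
    rewrite (_ : m t + t - (m t - t) = 2 * t) in hD; last by ring.
    apply: (@le_trans _ _ (eps * t / 2 * (M3 * (2 * t)))).
      by rewrite ler_wpM2l// divr_ge0// mulr_ge0// ltW.
    rewrite (_ : eps * t / 2 * (M3 * (2 * t)) = eps * M3 * t ^+ 2); last by field.
    by apply: ler_piMr; [rewrite mulr_ge0// ltW|rewrite expr_le1].
  have hAD := ler_normB A (eps * t / 2 * D).
  apply: (@le_trans _ _ (1 * `|A - eps * t / 2 * D|)).
    by rewrite ler_wpM2r.
  by rewrite mul1r (le_trans hAD)// lerD.
rewrite subr0 !mulr1 lerD2l; apply: ler_wpM2l; first exact: ltW.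
apply: ler_wpM2r => //; apply: ler_wpM2r; last by lra.
by rewrite invr_ge0 mulr_ge0// ltW.
Qed.

End gauss_kernel.

(** * Gaussian averages of Lipschitz functions *)

Section gauss_average.
Context {R : realType}.
Implicit Types v m s : R.
Local Notation mu := (@lebesgue_measure R).

Lemma gauss_normal_pdf v m s : 0 < v ->
  gauss v (m - s) = normal_pdf m (Num.sqrt v) s.
Proof.
move=> v0; have sv : 0 < Num.sqrt v by rewrite sqrtr_gt0.
rewrite normal_pdfE ?gt_eqF// /gauss /normal_peak /normal_fun.
rewrite sqr_sqrtr ?ltW// -(sqrtrM v) ?mulr_ge0 ?pi_ge0// mulrC.
congr (_^-1 * expR _); first by congr Num.sqrt; rewrite -[RHS]mulr_natr; ring.
by rewrite -[v *+ 2]mulr_natr mulNr (mulrC v); congr (- (_ / _)); ring.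
Qed.

Lemma integrable_gauss v m : 0 < v ->
  mu.-integrable setT (EFin \o (fun s => gauss v (m - s))).
Proof.
move=> v0; have := @integrable_normal_pdf R m (Num.sqrt v).
by apply: eq_integrable => // s _ /=; rewrite gauss_normal_pdf.
Qed.

Lemma Rintegral_gauss v m : 0 < v -> \int[mu]_s gauss v (m - s) = 1.
Proof.
move=> v0; rewrite /Rintegral.
under eq_integral do rewrite gauss_normal_pdf//.
by rewrite integral_normal_pdf.
Qed.

Lemma measurable_gauss v m : 0 < v ->
  measurable_fun setT (fun s => gauss v (m - s)).
Proof.
move=> v0; rewrite (_ : (fun s => _) = normal_pdf m (Num.sqrt v)).
  exact: measurable_normal_pdf.
by apply/funext => s; rewrite gauss_normal_pdf.
Qed.

Lemma gauss_dominated (h : R -> R) A v m : 0 < v -> measurable_fun setT h ->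
  (forall s, `|h s| <= A * gauss v (m - s)) ->
  mu.-integrable setT (EFin \o h) /\ `|\int[mu]_s h s| <= A.
Proof.
move=> v0 mh hA.
have iA : mu.-integrable setT (EFin \o (fun s => A * gauss v (m - s))).
  exact: integrableZl (integrable_gauss m v0).
have ih : mu.-integrable setT (EFin \o h).
  apply: le_integrable iA => //; first exact/measurable_EFinP.
  by move=> s _ /=; rewrite lee_fin (le_trans (hA s))// ler_norm.
split=> //; apply: (le_trans (le_normr_Rintegral _ ih)) => //.
apply: (@le_trans _ _ (\int[mu]_s (A * gauss v (m - s)))).
  apply: le_Rintegral => //; exact: integrable_norm.
by rewrite RintegralZl ?Rintegral_gauss ?mulr1//; exact: integrable_gauss.
Qed.

(** E phi(Z) for Z Gaussian of mean [m] and variance [v], in the convolution form of the integral in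
    [ubar]. *)
Definition gauss_avg (phi : R -> R) v m := \int[mu]_s (gauss v (m - s) * phi s).

Definition lipschitz_with (L : R) (phi : R -> R) :=
  forall x y, `|phi x - phi y| <= L * `|x - y|.

Lemma lipschitz_with_measurable L (phi : R -> R) : lipschitz_with L phi ->
  measurable_fun setT phi.
Proof.
move=> hL; apply: continuous_measurable_fun => x.
have L0 : 0 <= L.
  by have := le_trans (normr_ge0 _) (hL 1 0); rewrite subr0 normr1 mulr1.
apply/cvgrPdist_le => e e0; near=> y.
apply: (le_trans (hL _ _)); apply: (@le_trans _ _ (L * (e / (L + 1)))).
  rewrite ler_wpM2l//; near: y; apply: cvgr_dist_le; first exact: cvg_id.
  by rewrite divr_gt0// ltr_wpDl.
rewrite mulrCA; apply: ler_piMr; first exact: ltW.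
by rewrite ler_pdivrMr ?mul1r ?lerDl// ltr_wpDl.
Unshelve. all: by end_near.
Qed.

(** With centre [m], the integrand is at most L |m - s| times the density, and doubling the variance
    absorbs the linear factor. Moving the centre to [c] adds a multiple of the density, which keeps
    integrability. *)
Lemma gauss_mul_center_dominated (phi : R -> R) L v m c :
  0 < v -> lipschitz_with L phi ->
  mu.-integrable setT (EFin \o (fun s => gauss v (m - s) * (phi s - phi c))) /\
  `|\int[mu]_s (gauss v (m - s) * (phi s - phi m))| <= L * (4 * Num.sqrt v).
Proof.
move=> v0 hL; have mphi := lipschitz_with_measurable hL.
have mh a : measurable_fun setT (fun s => gauss v (m - s) * (phi s - phi a)).
  apply: measurable_funM; first exact: measurable_gauss.
  exact: measurable_funB.
have L0 : 0 <= L.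
  by have := le_trans (normr_ge0 _) (hL 1 0); rewrite subr0 normr1 mulr1.
have h s : `|gauss v (m - s) * (phi s - phi m)| <=
    L * (4 * Num.sqrt v) * gauss (2 * v) (m - s).
  rewrite normrM ger0_norm ?gauss_ge0// mulrC -mulrA.
  apply: (@le_trans _ _ (L * (`|m - s| * gauss v (m - s)))).
    by rewrite [leRHS]mulrA ler_wpM2r ?gauss_ge0// (le_trans (hL _ _))// distrC.
  by rewrite ler_wpM2l// norm_mul_gauss_le.
have v2 : 0 < 2 * v by rewrite mulr_gt0.
have [i1 b1] := gauss_dominated v2 (mh m) h; split => //.
have i2 : mu.-integrable setT
    (EFin \o (fun s => (phi m - phi c) * gauss v (m - s))).
  exact: integrableZl (integrable_gauss m v0).
have := integrableD _ i1 i2; move=> /(_ measurableT).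
by apply: eq_integrable => // s _ /=; rewrite -EFinD; congr EFin; ring.
Qed.

Lemma gauss_avg_center (phi : R -> R) L v m c : 0 < v -> lipschitz_with L phi ->
  gauss_avg phi v m =
  \int[mu]_s (gauss v (m - s) * (phi s - phi c)) + phi c.
Proof.
move=> v0 hL; have [i1 _] := gauss_mul_center_dominated m c v0 hL.
rewrite -[X in _ + X]mulr1 -(Rintegral_gauss m v0).
rewrite -RintegralZl//; last exact: integrable_gauss.
rewrite -RintegralD//; last exact: integrableZl (integrable_gauss m v0).
by apply: eq_Rintegral => s _; ring.
Qed.

Lemma gauss_avg_sub_le (phi : R -> R) L v m : 0 < v -> lipschitz_with L phi ->
  `|gauss_avg phi v m - phi m| <= L * (4 * Num.sqrt v).
Proof.
move=> v0 hL; rewrite (gauss_avg_center m m v0 hL) addrK.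
by have [] := gauss_mul_center_dominated m m v0 hL.
Qed.

(** The weights (1 + eps) / 2, (1 - eps) / 2 and -1 sum to zero, so [phi c] can be subtracted from
    [phi] throughout. The pointwise kernel estimate is then integrated against L |c - s|, which
    costs a factor 4 sqrt (8 N); hence 4800 = 1200 * 4. *)
Lemma gauss_avg_two_point_le (phi : R -> R) L N eps kappa c :
  1 <= N -> 0 < eps < 2^-1 -> kappa = 1 - eps ^+ 2 -> lipschitz_with L phi ->
  `|(1 + eps) / 2 * gauss_avg phi (kappa * N) (c + (1 - eps))
   + (1 - eps) / 2 * gauss_avg phi (kappa * N) (c - (1 + eps))
   - gauss_avg phi (kappa * (N + 1)) c| <=
  4800 * L * (1 / N ^+ 2 + eps / (N * Num.sqrt N)) * Num.sqrt (8 * N).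
Proof.
move=> N1 e01 kE hL; have /andP[e0 e1] := e01.
have N0 : 0 < N by lra.
have k0 : 0 < kappa by rewrite kE; nra.
have V0 : 0 < kappa * N by rewrite mulr_gt0.
have V1 : 0 < kappa * (N + 1) by rewrite mulr_gt0//; lra.
have mphi := lipschitz_with_measurable hL.
have L0 : 0 <= L.
  by have := le_trans (normr_ge0 _) (hL 1 0); rewrite subr0 normr1 mulr1.
rewrite (gauss_avg_center _ c V0 hL) (gauss_avg_center _ c V0 hL).
rewrite (gauss_avg_center _ c V1 hL).
have [i1 _] := gauss_mul_center_dominated (c + (1 - eps)) c V0 hL.
have [i2 _] := gauss_mul_center_dominated (c - (1 + eps)) c V0 hL.
have [i3 _] := gauss_mul_center_dominated c c V1 hL.
pose D w := (1 + eps) / 2 * gauss (kappa * N) (w + (1 - eps))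
   + (1 - eps) / 2 * gauss (kappa * N) (w - (1 + eps))
   - gauss (kappa * (N + 1)) w.
have DE s : D (c - s) * (phi s - phi c) =
    (1 + eps) / 2 * (gauss (kappa * N) (c + (1 - eps) - s) * (phi s - phi c))
  + (1 - eps) / 2 * (gauss (kappa * N) (c - (1 + eps) - s) * (phi s - phi c))
  - gauss (kappa * (N + 1)) (c - s) * (phi s - phi c).
  rewrite /D (_ : c - s + (1 - eps) = c + (1 - eps) - s); last by ring.
  by rewrite (_ : c - s - (1 + eps) = c - (1 + eps) - s); ring.
have -> : forall a b d : R, (1 + eps) / 2 * (a + phi c)
    + (1 - eps) / 2 * (b + phi c) - (d + phi c) =
    (1 + eps) / 2 * a + (1 - eps) / 2 * b - d by move=> *; field.
have j1 := integrableZl measurableT ((1 + eps) / 2) i1.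
have j2 := integrableZl measurableT ((1 - eps) / 2) i2.
have j12 := integrableD measurableT j1 j2.
rewrite -!RintegralZl// -RintegralD// -RintegralB//.
under eq_Rintegral do rewrite -DE.
have mD : measurable_fun setT (fun s => D (c - s) * (phi s - phi c)).
  have /integrableP[+ _] := integrableB measurableT j12 i3.
  move=> /measurable_EFinP; apply: eq_measurable_fun => s _ /=.
  by rewrite DE.
have N16 : 0 < 2 * (8 * N) by lra.
set A := _ * Num.sqrt (8 * N).
suff h s : `|D (c - s) * (phi s - phi c)| <= A * gauss (2 * (8 * N)) (c - s).
  by have [] := gauss_dominated N16 mD h.
rewrite normrM.
set B := 1 / N ^+ 2 + eps / (N * Num.sqrt N).
have sN : 0 < Num.sqrt N by rewrite sqrtr_gt0.
have B0 : 0 <= B by rewrite addr_ge0// divr_ge0// ?exprn_ge0 ?mulr_ge0// ltW.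
apply: (@le_trans _ _
    (1200 * B * gauss (8 * N) (c - s) * (L * `|c - s|))).
  by rewrite ler_pM//; [exact: gauss_two_point_le|rewrite (distrC c)].
rewrite (_ : 1200 * B * gauss (8 * N) (c - s) * (L * `|c - s|) =
  1200 * L * B * (`|c - s| * gauss (8 * N) (c - s))); last by ring.
have -> : A * gauss (2 * (8 * N)) (c - s) =
  1200 * L * B * (4 * Num.sqrt (8 * N) * gauss (2 * (8 * N)) (c - s)).
  by rewrite /A -/B; ring.
have LB0 : 0 <= 1200 * L * B.
  apply: mulr_ge0; last exact: B0.
  apply: mulr_ge0; last exact: L0.
  exact: ler0n.
have N8 : 0 < 8 * N by rewrite mulr_gt0.
have hg := norm_mul_gauss_le (c - s) N8.
exact: (ler_wpM2l LB0 hg).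
Qed.

End gauss_average.

(** * Replacing the increments of the biased walk one at a time *)

Section random_walk.
Context {R : realType}.
Implicit Types (eps y : R) (n : nat).

(** Transition operator of the walk: [iter n (walk_step eps) phi y] is the expectation of [phi]
    after n steps from [y]. *)
Definition walk_step eps (f : R -> R) (y : R) : R :=
  (1 + eps) / 2 * f (y + 1) + (1 - eps) / 2 * f (y - 1).

Lemma walk_step_dist eps (f g : R -> R) y M : -1 <= eps <= 1 ->
  `|f (y + 1) - g (y + 1)| <= M -> `|f (y - 1) - g (y - 1)| <= M ->
  `|walk_step eps f y - walk_step eps g y| <= M.
Proof.
move=> /andP[e0 e1]; rewrite /walk_step !ler_norml => /andP[a b] /andP[c d].
by apply/andP; split; nra.
Qed.

Lemma sqrt8_le (N : R) : 0 < N -> Num.sqrt (8 * N) <= 3 * Num.sqrt N.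
Proof.
move=> N0; rewrite -[X in X * Num.sqrt N]ger0_norm// -sqrtr_sqr.
by rewrite -sqrtrM ?sqr_ge0// ler_wsqrtr//; lra.
Qed.

(** The fourth-order error is at most 3 N^(-3/2). With s and t the square roots of N and N + 1, 1/s
    - 1/t = 1 / (s t (s + t)) is of the same order. *)
Lemma inv_sqrt_telescope (N : R) : 1 <= N ->
  1 / N ^+ 2 * Num.sqrt (8 * N) <= 12 * (1 / Num.sqrt N - 1 / Num.sqrt (N + 1)).
Proof.
move=> N1; have N0 : 0 < N by lra.
have s0 : 0 < Num.sqrt N by rewrite sqrtr_gt0.
have t0 : 0 < Num.sqrt (N + 1) by rewrite sqrtr_gt0; lra.
have sE : N = Num.sqrt N ^+ 2 by rewrite sqr_sqrtr ?ltW.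
have tE : Num.sqrt (N + 1) ^+ 2 = Num.sqrt N ^+ 2 + 1.
  by rewrite !sqr_sqrtr//; lra.
have ts : Num.sqrt (N + 1) <= 10 / 7 * Num.sqrt N.
  rewrite -[X in X * Num.sqrt N]ger0_norm// -sqrtr_sqr -sqrtrM ?sqr_ge0//.
  by rewrite ler_wsqrtr//; lra.
have s8 := sqrt8_le N0.
move: s0 t0 sE tE ts; set s := Num.sqrt N; set t := Num.sqrt (N + 1).
move=> s0 t0 sE tE ts.
apply: (@le_trans _ _ (3 / s ^+ 3)).
  have -> : 3 / s ^+ 3 = 1 / N ^+ 2 * (3 * s).
    by rewrite sE; field; rewrite gt_eqF.
  by rewrite ler_wpM2l// divr_ge0// exprn_ge0// ltW.
have -> : 12 * (1 / s - 1 / t) = 12 / (s * t * (s + t)).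
  have -> : 12 / (s * t * (s + t)) =
      12 * (t ^+ 2 - s ^+ 2) / (s * t * (s + t)).
    by rewrite tE addrAC subrr add0r mulr1.
  by field; rewrite !gt_eqF// addr_gt0.
rewrite ler_pdivrMr ?exprn_gt0// mulrAC ler_pdivlMr ?mulr_gt0 ?addr_gt0//.
have h1 : s * t <= s * (10 / 7 * s) by rewrite ler_pM2l.
have h2 : s + t <= 17 / 7 * s by lra.
have st0 : 0 <= s * t by rewrite mulr_ge0// ltW.
have st1 : 0 <= s + t by rewrite addr_ge0// ltW.
have h3 := ler_pM st0 st1 h1 h2.
rewrite (_ : s * (10 / 7 * s) * (17 / 7 * s) = 170 / 49 * s ^+ 3) in h3; last by field.
have s3 : 0 < s ^+ 3 by rewrite exprn_gt0.
by clear -s3 h3; lra.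
Qed.

(** The skewness error is of order 1/N, and 1/N <= 2 / (N + 1) <= 2 (ln (N + 1) - ln N). *)
Lemma ln_telescope (N : R) : 1 <= N ->
  1 / (N * Num.sqrt N) * Num.sqrt (8 * N) <= 6 * (ln (N + 1) - ln N).
Proof.
move=> N1; have N0 : 0 < N by lra.
have s0 : 0 < Num.sqrt N by rewrite sqrtr_gt0.
have s8 := sqrt8_le N0.
have N10 : 0 < N + 1 by lra.
have lnE : ln N - ln (N + 1) = ln (1 + - (N + 1)^-1).
  rewrite -ln_div ?posrE//; congr ln; field.
  by rewrite gt_eqF.
have i1 : (N + 1)^-1 < 1 by rewrite invf_lt1//; lra.
have /le_ln1Dx hln : -1 < - (N + 1)^-1 by lra.
have i2 : 2^-1 * N^-1 <= (N + 1)^-1.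
  by rewrite -invfM lef_pV2 ?posrE; lra.
apply: (@le_trans _ _ (3 / N)); last first.
  have : (N + 1)^-1 <= ln (N + 1) - ln N by lra.
  by lra.
have -> : 3 / N = 1 / (N * Num.sqrt N) * (3 * Num.sqrt N).
  by field; rewrite !gt_eqF.
by rewrite ler_wpM2l// divr_ge0// mulr_ge0// ltW.
Qed.

(** Induction on the number of steps, starting from one since a Gaussian of variance 0 has no
    density. As [walk_step] averages, it does not amplify the error already made; the remaining
    two-point increment is then replaced at a cost that telescopes into the right-hand side. *)
Lemma walk_gauss_avg_le (phi : R -> R) L eps kappa n y :
  0 < eps < 2^-1 -> kappa = 1 - eps ^+ 2 -> lipschitz_with L phi ->
  `|iter n.+1 (walk_step eps) phi y
    - gauss_avg phi (kappa * n.+1%:R) (y + eps * n.+1%:R)| <=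
  L * (6 + 4800 * (12 * (1 - 1 / Num.sqrt n.+1%:R) + eps * (6 * ln n.+1%:R))).
Proof.
move=> e01 kE hL /=; have /andP[e0 e1] := e01.
have e11 : -1 <= eps <= 1 by lra.
have k0 : 0 < kappa by rewrite kE; nra.
have k1 : kappa <= 1 by rewrite kE; nra.
have L0 : 0 <= L.
  by have := le_trans (normr_ge0 _) (hL 1 0); rewrite subr0 normr1 mulr1.
elim: n y => [y|n IH y].
  rewrite !mulr1 sqrtr1 ln1 /=.
  have -> : L * (6 + 4800 * (12 * (1 - 1 / 1) + eps * (6 * 0))) = L * 2 + L * 4.
    by field.
  have -> : walk_step eps phi y - gauss_avg phi kappa (y + eps) =
    (walk_step eps phi y - walk_step eps (fun=> phi (y + eps)) y)
    - (gauss_avg phi kappa (y + eps) - phi (y + eps)).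
    by rewrite /walk_step; field.
  apply: (le_trans (ler_normB _ _)); apply: lerD.
    apply: walk_step_dist => //; apply: (le_trans (hL _ _)).
      by apply: ler_wpM2l => //; rewrite ler_norml; lra.
    by apply: ler_wpM2l => //; rewrite ler_norml; lra.
  apply: (le_trans (gauss_avg_sub_le _ k0 hL)).
  by apply: ler_wpM2l => //; rewrite ler_piMr// -sqrtr1 ler_wsqrtr.
have N1 : 1 <= n.+1%:R :> R by rewrite ler1n.
move: N1 IH; rewrite -[n.+2%:R]natr1; set N : R := n.+1%:R => N1 IH.
have IHs : `|walk_step eps (iter n.+1 (walk_step eps) phi) y
   - walk_step eps (fun x => gauss_avg phi (kappa * N) (x + eps * N)) y| <=
  L * (6 + 4800 * (12 * (1 - 1 / Num.sqrt N) + eps * (6 * ln N))).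
  by apply: walk_step_dist => //; exact: IH.
have := gauss_avg_two_point_le (y + eps * (N + 1)) N1 e01 kE hL.
rewrite (_ : y + eps * (N + 1) + (1 - eps) = y + 1 + eps * N); last by ring.
rewrite (_ : y + eps * (N + 1) - (1 + eps) = y - 1 + eps * N); last by ring.
move=> hstep; rewrite iterS.
set X := gauss_avg phi (kappa * (N + 1)) _ in hstep *.
apply: (le_trans (ler_distD
  (walk_step eps (fun x => gauss_avg phi (kappa * N) (x + eps * N)) y) _ _)).
apply: (le_trans (lerD IHs hstep)).
have t1 := inv_sqrt_telescope N1.
have t2 := ler_wpM2l (ltW e0) (ln_telescope N1).
rewrite (_ : 4800 * L * (1 / N ^+ 2 + eps / (N * Num.sqrt N)) *
  Num.sqrt (8 * N) = L * (4800 * (1 / N ^+ 2 * Num.sqrt (8 * N) +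
   eps * (1 / (N * Num.sqrt N) * Num.sqrt (8 * N))))); last by ring.
rewrite -mulrDr; apply: ler_wpM2l => //.
move: t1 t2; move: (1 / N ^+ 2 * _) (1 / (N * _) * _) (1 / Num.sqrt N).
move: (1 / Num.sqrt (N + 1)) (ln N) (ln (N + 1)); clear.
by move=> q l l' a b p t1 t2; lra.
Qed.

End random_walk.

(** * The exponent [theta] of the walk *)

Section bandit.
Context {R : realType}.
Variable eps : R.
Hypotheses (eps_gt0 : 0 < eps) (eps_lt1 : eps < 1).

(** Chosen so that [expR (- (theta * y))] is invariant under [walk_step eps]; the parameter sigma is
    2 eps / theta. *)
Definition theta := ln ((1 + eps) / (1 - eps)).
Local Notation sigma := (2 * eps / theta).
Local Notation phi := (phibar eps sigma (1 / eps)).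
Local Notation kappa := (1 - eps ^+ 2).

Lemma expR_theta : expR theta = (1 + eps) / (1 - eps).
Proof.
have [e0 e1] : 0 < eps /\ eps < 1 by [].
have h1 : 0 < 1 + eps by lra.
have h2 : 0 < 1 - eps by lra.
by rewrite /theta lnK// posrE divr_gt0.
Qed.

Lemma theta_ge : eps <= theta.
Proof.
have [e0 e1] : 0 < eps /\ eps < 1 by [].
have h1 : 0 < 1 + eps by lra.
have h2 : 0 < 1 - eps by lra.
have -> : theta = - ln (1 + - (2 * eps / (1 + eps))).
  rewrite /theta -lnV ?posrE; last first.
    by rewrite subr_gt0 ltr_pdivrMr//; lra.
  by congr ln; field; rewrite !gt_eqF//; lra.
have /le_ln1Dx h : -1 < - (2 * eps / (1 + eps)).
  by rewrite ltrN2 ltr_pdivrMr//; lra.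
have : eps <= 2 * eps / (1 + eps) by rewrite ler_pdivlMr//; nra.
lra.
Qed.

Lemma theta_gt0 : 0 < theta.
Proof. exact: (lt_le_trans eps_gt0 theta_ge). Qed.

Lemma theta_le : theta * (1 - eps) <= 2 * eps.
Proof.
have [e0 e1] : 0 < eps /\ eps < 1 by [].
have h2 : 0 < 1 - eps by lra.
rewrite -ler_pdivlMr// /theta.
have -> : (1 + eps) / (1 - eps) = 1 + 2 * eps / (1 - eps).
  by field; rewrite gt_eqF.
apply: le_ln1Dx; apply: (@lt_trans _ _ 0); first by lra.
by rewrite divr_gt0// mulr_gt0.
Qed.

Lemma theta_kappa_le : theta * kappa <= 2 * eps * (1 + eps).
Proof. by have := theta_le; move: eps_gt0; nra. Qed.

(** For X an increment of the walk, the two halves of E exp(- theta X / 2) coincide and add up to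
    the right-hand side, so [Num.sqrt kappa] is the decay rate per step. *)
Lemma sqrt_kappaE : Num.sqrt kappa = (1 - eps) * expR (theta / 2).
Proof.
have [e0 e1] : 0 < eps /\ eps < 1 by [].
have h2 : 0 < 1 - eps by lra.
have -> : kappa = ((1 - eps) * expR (theta / 2)) ^+ 2.
  rewrite exprMn -expRM_natl (_ : 2 * (theta / 2) = theta); last by field.
  by rewrite expR_theta; field; rewrite gt_eqF.
by rewrite sqrtr_sqr ger0_norm// mulr_ge0 ?expR_ge0// ltW.
Qed.

(** * The function [phibar]: Poisson equation, exact regret, exponential decay *)

Lemma phibar_le0 y : y <= 0 -> phi y = - 2 * y.
Proof. by rewrite /phibar => ->. Qed.

Lemma phibar_ge0 y : 0 <= y -> phi y = (expR (- (theta * y)) - 1) / eps.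
Proof.
have [e0 e1] : 0 < eps /\ eps < 1 by [].
rewrite /phibar => y0; case: ifPn => [y0'|_].
  have -> : y = 0 by apply/eqP; rewrite eq_le y0 y0'.
  by rewrite !mulr0 oppr0 expR0 subrr mul0r.
rewrite (_ : - 2 * eps * y / (2 * eps / theta) = - (theta * y)).
  by field; rewrite gt_eqF.
by field; rewrite !gt_eqF// theta_gt0.
Qed.

(** [phibar] is nonincreasing, with slope -2 left of 0 and slopes at most theta / eps in absolute
    value right of 0; the sum of the two constants also covers pairs on either side of 0. *)
Lemma phibar_lipschitz : lipschitz_with (2 + theta / eps) phi.
Proof.
have [e0 e1] : 0 < eps /\ eps < 1 by [].
have t0 := theta_gt0.
have te : 0 < theta / eps by rewrite divr_gt0.
have expB x y : 0 <= x -> x <= y ->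
    0 <= (expR (- (theta * x)) - expR (- (theta * y))) / eps
      <= theta / eps * (y - x).
  move=> x0 xy; apply/andP; split.
    apply: divr_ge0; last exact: ltW.
    by rewrite subr_ge0 ler_expR lerN2 ler_pM2l.
  rewrite mulrAC ler_pM2r ?invr_gt0//.
  have -> : expR (- (theta * y)) = expR (- (theta * x)) * expR (- (theta * (y - x))).
    by rewrite -expRD; congr expR; ring.
  have a1 : expR (- (theta * x)) <= 1.
    by rewrite expR_le1 oppr_le0 mulr_ge0// ltW.
  have a0 := expR_ge0 (- (theta * x)).
  have b1 := expR_ge1Dx (- (theta * (y - x))).
  have b0 : 0 <= theta * (y - x) by rewrite mulr_ge0 ?subr_ge0// ltW.
  nra.
have mono x y : x <= y -> 0 <= phi x - phi y <= (2 + theta / eps) * (y - x).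
  move=> xy; have [y0|y0] := leP y 0.
    by rewrite (phibar_le0 y0) (phibar_le0 (le_trans xy y0)); nra.
  have [x0|x0] := leP x 0.
    rewrite (phibar_le0 x0) (phibar_ge0 (ltW y0)).
    have := expB 0 y (lexx _) (ltW y0).
    by rewrite mulr0 oppr0 expR0; nra.
  rewrite (phibar_ge0 (ltW x0)) (phibar_ge0 (ltW y0)).
  have := expB x y (ltW x0) xy.
  rewrite (_ : _ / eps - _ / eps =
    (expR (- (theta * x)) - expR (- (theta * y))) / eps); last by ring.
  by nra.
move=> x y; have [xy|yx] := leP x y.
  have /andP[h1 h2] := mono x y xy.
  by rewrite ger0_norm// (distrC x) (ger0_norm (_ : 0 <= y - x))// subr_ge0.
have /andP[h1 h2] := mono y x (ltW yx).
by rewrite distrC ger0_norm// (ger0_norm (_ : 0 <= x - y))// subr_ge0 ltW.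
Qed.

(** The Poisson equation, with source 2 eps times the probability of pulling the risky arm. Left of
    0 the linear piece has drift -2 eps; right of 0 the exponential is invariant; at 0 the two
    pieces meet, and b = 1 / eps is the value that balances them. Unit steps from an integer never
    jump over 0. *)
Lemma walk_step_phibar (k : int) :
  walk_step eps phi k%:~R + 2 * eps * (if k < 0 then 1 else if k == 0 then 1 / 2 else 0)
  = phi k%:~R.
Proof.
have [e0 e1] : 0 < eps /\ eps < 1 by [].
rewrite /walk_step; have [k0|k0|->] := ltgtP k 0.
- have : (k + 1)%:~R <= (0%:~R : R) by rewrite ler_int lezD1.
  by rewrite intrD => h1; rewrite !phibar_le0; lra.
- have h1 : (1 : R) <= k%:~R by rewrite -[1]/(1%:~R) ler_int -gtz0_ge1.
  rewrite !phibar_ge0; [|lra..].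
  set y := k%:~R.
  have -> : - (theta * (y + 1)) = - (theta * y) - theta by ring.
  have -> : - (theta * (y - 1)) = - (theta * y) + theta by ring.
  rewrite expRB expRD expR_theta; field.
  by rewrite !gt_eqF//; lra.
- rewrite mulr0z add0r sub0r phibar_ge0// (@phibar_le0 (-1)) ?oppr_le0// phibar_le0//.
  rewrite mulr1 expRN expR_theta; field.
  by rewrite !gt_eqF//; lra.
Qed.

(** The law of -g2 is that of g1, so y moves in the same way whichever arm is pulled, and the
    Poisson equation absorbs the cost of each pull of the risky arm. *)
Lemma vbar_togo_walk n xi (s2 k : int) : xi - eps * n%:R = k%:~R ->
  vbar_togo eps n xi s2 =
  2 * eps * s2%:~R + phi k%:~R - iter n (walk_step eps) phi k%:~R.
Proof.
have [e0 e1] : 0 < eps /\ eps < 1 by [].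
elim: n xi s2 k => [|n IH] xi s2 k hk; first by rewrite /= addrK.
pose W (u : bool) := phi (k%:~R + reward R u)
  - iter n (walk_step eps) phi (k%:~R + reward R u).
have V g1 g2 I : vbar_togo eps n (xi + dxi eps g1 g2 I) (s2 + ds2 I) =
    2 * eps * (s2%:~R + (if I then 1 else 0)) + W (if I then ~~ g2 else g1).
  pose u := if I then ~~ g2 else g1.
  rewrite (IH _ _ (k + (if u then 1 else -1))); last first.
    rewrite intrD -hk -natr1 /dxi /u; clear u; case: I; case: g1; case: g2 => /=;
      rewrite /reward ?mulrN1z ?mulr1z; ring.
  rewrite !intrD /W /ds2 -addrA /u /reward; clear u.
  by case: I; case: g1; case: g2 => /=.
rewrite [LHS]/= /expect_round !big_bool !V /= -walk_step_phibar.
rewrite /walk_step /reward_law /myopic /W /reward.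
have -> : xi + eps * - n.+1%:R = k%:~R by rewrite -hk; ring.
rewrite ltr0z intr_eq0.
by have [k0|k0|k0] := ltgtP k 0; field.
Qed.

(** Halving the rate leaves room for the linear growth on the left: as eps <= theta, 1 - 2 eps y <=
    4 (1 - theta y / 2) for y <= 0. The rate theta / 2 also minimises the exponential moment of an
    increment. *)
Lemma phibar_exp_bound y :
  `|phi y + 1 / eps| <= 4 / eps * expR (- (theta / 2 * y)).
Proof.
have [e0 e1] : 0 < eps /\ eps < 1 by [].
have te := theta_ge; have t0 := theta_gt0.
have i0 : 0 < eps^-1 by rewrite invr_gt0.
have [y0|y0] := leP y 0.
  rewrite phibar_le0// ger0_norm; last by lra.
  have -> : - 2 * y + 1 / eps = (1 - 2 * eps * y) / eps by field; rewrite gt_eqF.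
  rewrite [leRHS]mulrAC ler_pM2r//.
  by have := expR_ge1Dx (- (theta / 2 * y)); nra.
rewrite (phibar_ge0 (ltW y0)).
rewrite (_ : (expR (- (theta * y)) - 1) / eps + 1 / eps = expR (- (theta * y)) / eps); last by ring.
rewrite ger0_norm; last by rewrite divr_ge0 ?expR_ge0// ltW.
rewrite [leRHS]mulrAC ler_pM2r//.
apply: (@le_trans _ _ (expR (- (theta / 2 * y)))).
  by rewrite ler_expR; nra.
by have := expR_ge0 (- (theta / 2 * y)); lra.
Qed.

(** One step multiplies exp(- theta y / 2) by exactly [Num.sqrt kappa]. *)
Lemma walk_exp_bound n y :
  `|iter n (walk_step eps) phi y + 1 / eps| <=
  4 / eps * Num.sqrt kappa ^+ n * expR (- (theta / 2 * y)).
Proof.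
have [e0 e1] : 0 < eps /\ eps < 1 by [].
have h2 : 0 < 1 - eps by lra.
elim: n y => [y|n IH y]; first by rewrite mulr1; exact: phibar_exp_bound.
rewrite iterS {1}/walk_step.
have hp := IH (y + 1); have hm := IH (y - 1).
set A := iter _ _ _ _ in hp *; set B := iter _ _ _ _ in hm *.
set c := 4 / eps * Num.sqrt kappa ^+ n in hp hm.
rewrite (_ : _ + 1 / eps =
  (1 + eps) / 2 * (A + 1 / eps) + (1 - eps) / 2 * (B + 1 / eps)); last first.
  by field; rewrite gt_eqF.
apply: (le_trans (ler_normD _ _)).
rewrite (normrM ((1 + eps) / 2)) (normrM ((1 - eps) / 2)).
rewrite (ger0_norm (_ : 0 <= (1 + eps) / 2)); last by lra.
rewrite (ger0_norm (_ : 0 <= (1 - eps) / 2)); last by lra.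
apply: (@le_trans _ _ ((1 + eps) / 2 * (c * expR (- (theta / 2 * (y + 1))))
   + (1 - eps) / 2 * (c * expR (- (theta / 2 * (y - 1)))))).
  by apply: lerD; apply: ler_wpM2l => //; lra.
rewrite (_ : 4 / eps * Num.sqrt kappa ^+ n.+1 = c * Num.sqrt kappa); last first.
  by rewrite exprSr /c mulrA.
rewrite sqrt_kappaE.
have -> : - (theta / 2 * (y + 1)) = - (theta / 2 * y) - theta / 2 by ring.
have -> : - (theta / 2 * (y - 1)) = - (theta / 2 * y) + theta / 2 by ring.
rewrite expRB expRD.
have q0 := expR_gt0 (theta / 2); set q := expR (theta / 2) in q0 *.
have qE : 1 + eps = (1 - eps) * q ^+ 2.
  rewrite /q -expRM_natl (_ : 2 * (theta / 2) = theta); last by field.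
  by rewrite expR_theta; field; rewrite gt_eqF.
by rewrite qE le_eqVlt; apply/orP; left; apply/eqP; field; rewrite gt_eqF.
Qed.

(** Exponential tilting: completing the square turns the density times exp(- theta s / 2) into the
    moment generating function times a Gaussian density with mean shifted by - theta v / 2. *)
Lemma gauss_exp_bound (v m : R) : 0 < v ->
  `|gauss_avg phi v m + 1 / eps| <=
  4 / eps * expR (- (theta / 2 * m) + theta ^+ 2 * v / 8).
Proof.
have [e0 e1] : 0 < eps /\ eps < 1 by [].
move=> v0; rewrite (gauss_avg_center m 0 v0 phibar_lipschitz).
have [i1 _] := gauss_mul_center_dominated m 0 v0 phibar_lipschitz.
have p0 : phi 0 = 0 by rewrite phibar_le0// mulr0.
rewrite p0 addr0.
have i2 := integrableZl measurableT (1 / eps) (integrable_gauss m v0).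
have hc : 1 / eps = \int[lebesgue_measure]_s (1 / eps * gauss v (m - s)).
  rewrite RintegralZl ?Rintegral_gauss ?mulr1//; exact: integrable_gauss.
rewrite [X in _ + X]hc.
rewrite p0 in i1; rewrite -RintegralD//.
rewrite (@eq_Rintegral _ _ R lebesgue_measure setT
    (fun s => gauss v (m - s) * (phi s + 1 / eps)));
  last by move=> s _ /=; ring.
have mphi := lipschitz_with_measurable phibar_lipschitz.
have mh : measurable_fun setT (fun s : R => gauss v (m - s) * (phi s + 1 / eps)).
  apply: measurable_funM; first exact: measurable_gauss.
  exact: measurable_funD.
suff h s : `|gauss v (m - s) * (phi s + 1 / eps)| <=
    4 / eps * expR (- (theta / 2 * m) + theta ^+ 2 * v / 8) *
    gauss v (m - theta / 2 * v - s).
  by have [] := gauss_dominated v0 mh h.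
rewrite normrM ger0_norm ?gauss_ge0//.
apply: (le_trans (ler_wpM2l (gauss_ge0 _ _) (phibar_exp_bound s))).
rewrite le_eqVlt; apply/orP; left; apply/eqP.
rewrite /gauss.
have -> : - (theta / 2 * m) + theta ^+ 2 * v / 8 =
  - ((m - s) ^+ 2 / (2 * v)) + - (theta / 2 * s)
  + (m - theta / 2 * v - s) ^+ 2 / (2 * v).
  by field; rewrite gt_eqF.
rewrite [expR (_ + _ + _)]expRD expRD (expRN ((m - theta / 2 * v - s) ^+ 2 / (2 * v))).
set d := Num.sqrt (2 * pi) * Num.sqrt v.
have d0 : 0 < d by rewrite mulr_gt0 ?sqrt2pi_gt0// sqrtr_gt0.
by field; rewrite !gt_eqF// expR_gt0.
Qed.

(** The exponent is linear in N with nonpositive slope, because theta kappa <= 4 eps, so N = 1 is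
    the worst case. *)
Lemma gauss_exponent_le (N : R) : 1 <= N ->
  - (theta / 2 * (eps * N)) + theta ^+ 2 * (kappa * N) / 8 <=
  - (theta / 2 * eps) + theta ^+ 2 * kappa / 8.
Proof.
have [e0 e1] : 0 < eps /\ eps < 1 by [].
move=> N1; have t0 := theta_gt0; have tk := theta_kappa_le.
have h : theta * kappa <= 4 * eps by nra.
have h' : 0 <= theta / 2 * (eps - theta * kappa / 4).
  by rewrite mulr_ge0//; lra.
rewrite -subr_ge0.
rewrite (_ : _ - _ = theta / 2 * (eps - theta * kappa / 4) * (N - 1)); last by field.
by rewrite mulr_ge0// subr_ge0.
Qed.

(** Serves for eps close to 1, where theta blows up: the exponent is at most 3 - theta / 2, and
    exp(- theta / 2) <= sqrt kappa. *)
Lemma expR_gauss_le : expR (- (theta / 2 * eps) + theta ^+ 2 * kappa / 8) <=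
  expR 3 * Num.sqrt kappa.
Proof.
have [e0 e1] : 0 < eps /\ eps < 1 by [].
have h2 : 0 < 1 - eps by lra.
have t0 := theta_gt0; have tl := theta_le.
have q0 := expR_gt0 (theta / 2).
have qE : expR (theta / 2) ^+ 2 = (1 + eps) / (1 - eps).
  rewrite -expRM_natl (_ : 2 * (theta / 2) = theta); last by field.
  exact: expR_theta.
have tq : theta / 2 <= expR (theta / 2) by have := expR_ge1Dx (theta / 2); lra.
have t2 : theta ^+ 2 * (1 - eps) <= 4 * (1 + eps).
  rewrite -ler_pdivlMr// -mulrA -qE.
  rewrite (_ : theta ^+ 2 = 4 * (theta / 2) ^+ 2); last by field.
  by rewrite ler_pM2l// ler_sqr// nnegrE ?divr_ge0 ?ltW.
apply: (@le_trans _ _ (expR (3 - theta / 2))).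
  rewrite ler_expR; nra.
rewrite expRB ler_wpM2l ?expR_ge0// sqrt_kappaE.
rewrite -[leLHS]mul1r ler_pdivrMr// -mulrA -expr2 qE mulrC divfK ?gt_eqF//.
by lra.
Qed.

End bandit.

(** * The explicit constant and the kernel of [ubar] *)

Section bounds.
Context {R : realType}.

Lemma expRN_le_inv (x : R) : 0 < x -> expR (- x) <= x^-1.
Proof.
move=> x0; rewrite expRN lef_pV2 ?posrE ?expR_gt0//.
by have := expR_ge1Dx x; lra.
Qed.

(** One summand per regime: eps >= 1/2; eps < 1/2 with n > exp(3 / eps); eps < 1/2 with n <= exp(3 /
    eps). In the last two, the bounds 40 and 6 * (6 + 4800 * 30) are doubled because sqrt kappa >=
    1/2; 30 is 12 + 6 * 3. *)
Definition walk_gauss_const : R :=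
  8 * (1 + expR 3) + 80 + 12 * (6 + 4800 * 30).

Lemma Phi_gauss (kappa s t : R) : Phi kappa s t = gauss (kappa * - t) s.
Proof.
rewrite /Phi /gauss mul1r mulrC; congr (expR _ / _).
  by rewrite !mulrN invrN mulrN opprK mulrA.
rewrite -sqrtrM ?mulr_ge0 ?pi_ge0//; congr Num.sqrt; ring.
Qed.

End bounds.

(** * Comparison of walk and Gaussian in the three regimes *)

Section walk_vs_gauss.
Context {R : realType}.
Variable eps : R.
Hypotheses (eps_gt0 : 0 < eps) (eps_lt1 : eps < 1).
Local Notation phi := (phibar eps (2 * eps / theta eps) (1 / eps)).
Local Notation kappa := (1 - eps ^+ 2).

Lemma walk_gauss_exp_le n : (1 <= n)%N ->
  `|iter n (walk_step eps) phi 0 - gauss_avg phi (kappa * n%:R) (eps * n%:R)| <=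
  4 / eps * (Num.sqrt kappa ^+ n
    + expR (- (theta eps / 2 * (eps * n%:R)) + theta eps ^+ 2 * (kappa * n%:R) / 8)).
Proof.
move=> n1; have [e0 e1] : 0 < eps /\ eps < 1 by [].
have v0 : 0 < kappa * n%:R by rewrite mulr_gt0 ?ltr0n//; nra.
have := walk_exp_bound e0 e1 n 0.
rewrite mulr0 oppr0 expR0 mulr1 => h1.
have := gauss_exp_bound e0 e1 (eps * n%:R) v0.
move=> h2.
set X := iter _ _ _ _ in h1 *; set Y := gauss_avg _ _ _ in h2 *.
rewrite (_ : X - Y = (X + 1 / eps) - (Y + 1 / eps)); last by ring.
by rewrite mulrDr (le_trans (ler_normB _ _))// lerD.
Qed.

Lemma walk_gauss_le n : (1 <= n)%N ->
  `|iter n (walk_step eps) phi 0 - gauss_avg phi (kappa * n%:R) (eps * n%:R)| <=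
  walk_gauss_const * Num.sqrt kappa.
Proof.
move=> n1; have [e0 e1] : 0 < eps /\ eps < 1 by [].
have k0 : 0 < kappa by nra.
have k1 : kappa <= 1 by nra.
have s0 : 0 <= Num.sqrt kappa by rewrite sqrtr_ge0.
have s1 : Num.sqrt kappa <= 1 by rewrite -[leRHS]sqrtr1 ler_wsqrtr.
have E3 := expR_ge0 (3 : R).
have N1 : 1 <= n%:R :> R by rewrite ler1n.
have hexp := walk_gauss_exp_le n1.
have te := theta_ge e0 e1.
have [eh|eh] := leP 2^-1 eps.
  apply: (le_trans hexp).
  apply: (@le_trans _ _ (8 * ((1 + expR 3) * Num.sqrt kappa))); last first.
    by rewrite /walk_gauss_const; nra.
  have b1 : Num.sqrt kappa ^+ n <= Num.sqrt kappa.
    by rewrite -[leRHS]expr1 ler_wiXn2l// s0.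
  have b2 := gauss_exponent_le e0 e1 N1.
  rewrite -ler_expR in b2.
  have b3 := le_trans b2 (expR_gauss_le e0 e1).
  apply: ler_pM.
  - by rewrite divr_ge0// ltW.
  - by rewrite addr_ge0 ?exprn_ge0 ?expR_ge0.
  - by rewrite ler_pdivrMr//; lra.
  - by rewrite [leRHS]mulrDl mul1r; exact: lerD.
have sh : 2^-1 <= Num.sqrt kappa.
  rewrite -[leLHS]ger0_norm// -sqrtr_sqr ler_wsqrtr//; nra.
(* The threshold keeps the summed skewness errors, eps * 6 * ln n, at most 18. *)
have [small|large] := leP (eps * ln n%:R) 3.
  have L6 : 2 + theta eps / eps <= 6.
    have := theta_le e0 e1 => tl.
    have : theta eps / eps <= 4 by rewrite ler_pdivrMr//; nra.
    by lra.
  have hL : lipschitz_with 6 phi.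
    move=> x y; apply: (le_trans (phibar_lipschitz e0 e1 x y)).
    by rewrite ler_wpM2r.
  have e02 : 0 < eps < 2^-1 by rewrite e0 eh.
  case: n n1 N1 hexp small => // n _ N1 _ small.
  have := walk_gauss_avg_le n 0 e02 (erefl kappa) hL.
  rewrite add0r => h; apply: (le_trans h).
  have i0 : 0 <= 1 / Num.sqrt n.+1%:R :> R by rewrite divr_ge0.
  apply: (@le_trans _ _ (6 * (6 + 4800 * 30))).
    by move: i0 small; move: (1 / _) (ln _); clear; move=> a b; lra.
  by rewrite /walk_gauss_const; clear - sh E3; nra.
have ln1 : 3 / eps < ln n%:R by rewrite ltr_pdivrMr// mulrC.
(* exp(3 / eps) >= eps^(-3) yields eps^2 n >= 1 / eps; the exponentials below are then O(eps) and
   offset the prefactor 4 / eps. *)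
have n3 : (eps^-1) ^+ 3 <= n%:R.
  have n0 : 0 < n%:R :> R by lra.
  rewrite -[leRHS]lnK ?posrE//.
  apply: (@le_trans _ _ (expR (3 / eps))); last by rewrite ler_expR ltW.
  rewrite (expRM_natl 3) lerXn2r// ?nnegrE ?expR_ge0 ?invr_ge0//; first exact: ltW.
  by have := expR_ge1Dx (eps^-1); lra.
have x1 : eps^-1 <= eps ^+ 2 * n%:R.
  rewrite (_ : eps^-1 = eps ^+ 2 * (eps^-1) ^+ 3); last by field; rewrite gt_eqF.
  by rewrite ler_wpM2l// sqr_ge0.
have i0 : 0 < eps^-1 by rewrite invr_gt0.
have x0 : 0 < eps ^+ 2 * n%:R by lra.
have inv_le (c : R) : 0 < c -> (c * (eps ^+ 2 * n%:R))^-1 <= c^-1 * eps.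
  move=> c0; rewrite invfM; apply: ler_wpM2l; first by rewrite invr_ge0 ltW.
  by rewrite -[leRHS]invrK lef_pV2 ?posrE.
have b1 : Num.sqrt kappa ^+ n <= 2 * eps.
  have sk : Num.sqrt kappa <= expR (- (2^-1 * eps ^+ 2)).
    apply: (@le_trans _ _ (1 - 2^-1 * eps ^+ 2)); last exact: expR_ge1Dx.
    have h : 0 <= 1 - 2^-1 * eps ^+ 2 by nra.
    rewrite -[leRHS]ger0_norm// -sqrtr_sqr ler_wsqrtr//; nra.
  apply: (@le_trans _ _ (expR (- (2^-1 * eps ^+ 2)) ^+ n)).
    by rewrite lerXn2r ?nnegrE ?expR_ge0.
  rewrite -expRM_natl (_ : _ * - _ = - (2^-1 * (eps ^+ 2 * n%:R))); last by ring.
  apply: (le_trans (expRN_le_inv _)); first by rewrite mulr_gt0.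
  by rewrite (le_trans (inv_le _ _))// invrK.
have b2 : expR (- (theta eps / 2 * (eps * n%:R))
    + theta eps ^+ 2 * (kappa * n%:R) / 8) <= 8 * eps.
  apply: (@le_trans _ _ (expR (- (8^-1 * (eps ^+ 2 * n%:R))))); last first.
    apply: (le_trans (expRN_le_inv _)); first by rewrite mulr_gt0.
    by rewrite (le_trans (inv_le _ _))// invrK.
  rewrite ler_expR.
  have tk : theta eps * kappa <= 2 * eps * (1 + eps) := theta_kappa_le e0 e1.
  (* As eps < 1/2, theta kappa <= 3 eps, so the drift beats the variance term by a fixed fraction of
     eps. *)
  have g : eps / 4 <= eps - theta eps * kappa / 4 by nra.
  have h : 8^-1 * eps ^+ 2 <= theta eps / 2 * (eps - theta eps * kappa / 4).
    rewrite (_ : 8^-1 * eps ^+ 2 = (eps / 2) * (eps / 4)); last by field.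
    by apply: ler_pM => //; lra.
  rewrite (_ : - (theta eps / 2 * _) + _ =
    - (theta eps / 2 * (eps - theta eps * kappa / 4) * n%:R)); last by field.
  by rewrite lerN2 mulrA ler_wpM2r.
apply: (le_trans hexp).
apply: (@le_trans _ _ 40).
  rewrite (_ : 40 = 4 / eps * (2 * eps + 8 * eps)); last by field; rewrite gt_eqF.
  by apply: ler_wpM2l; [rewrite divr_ge0// ltW|exact: lerD].
by rewrite /walk_gauss_const; clear - sh E3; nra.
Qed.

End walk_vs_gauss.

Theorem mainTheorem7 (R : realType) :
  let kappa (eps : R) : R := 1 - eps ^+ 2 in
  let sigma (eps : R) : R := 2 * eps / ln ((1 + eps) / (1 - eps)) in
  let b (eps : R) : R := 1 / eps in
  exists E0 : R -> int -> R,
    [/\ forall (T : nat) (eps : R), (1 <= T)%N -> 0 < eps < 1 ->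
          `| ubar eps (kappa eps) (sigma eps) (b eps) (eps * T%:R) 0 (- T%:R)
             - vbar eps (eps * T%:R) 0 (- T%:Z) | <= E0 eps (- T%:Z),
        exists C : R, forall (T : nat) (eps : R), (1 <= T)%N -> 0 < eps < 1 ->
          `| E0 eps (- T%:Z) | <= C * ((1 + 1 / sigma eps) * Num.sqrt (kappa eps))
      & exists C : R, \forall eps \near (0 : R)^'+, forall T : nat, (1 <= T)%N ->
          `| E0 eps (- T%:Z) | <= C].
Proof.
move=> kappa sigma b.
have K0 : 0 <= walk_gauss_const :> R.
  by have := expR_ge0 (3 : R); rewrite /walk_gauss_const; lra.
have normE eps : `|walk_gauss_const * Num.sqrt (kappa eps)|
    = walk_gauss_const * Num.sqrt (kappa eps).
  by rewrite ger0_norm// mulr_ge0.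
(* A single error term, constant in time, serves both estimates: 1 + 1 / sigma >= 1 and kappa <=
   1. *)
exists (fun eps _ => walk_gauss_const * Num.sqrt (kappa eps)); split.
- move=> n eps n1 /andP[e0 e1].
  have := walk_gauss_le e0 e1 n1.
  set X := iter _ _ _ _; set Y := gauss_avg _ _ _ => h.
  suff -> : ubar eps (kappa eps) (sigma eps) (b eps) (eps * n%:R) 0 (- n%:R)
      - vbar eps (eps * n%:R) 0 (- n%:Z) = X - Y by [].
  rewrite /vbar abszN absz_nat.
  (* At the start y = eps n - eps n = 0, an integer; the term phibar(0) occurs in both functions and
     cancels. *)
  rewrite (@vbar_togo_walk _ _ e0 e1 n (eps * n%:R) 0 0) ?subrr//.
  rewrite /ubar mulrN subrr -/X !mulr0 !add0r.
  under eq_Rintegral do rewrite Phi_gauss opprK.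
  by rewrite -/(gauss_avg _ _ _) -/Y; ring.
- exists walk_gauss_const => n eps n1 /andP[e0 e1].
  rewrite normE ler_wpM2l// ler_peMl//.
  rewrite lerDl divr_ge0// divr_ge0 ?mulr_ge0 ?ltW// (theta_gt0 e0 e1)//.
- exists walk_gauss_const.
  near=> eps => n _; rewrite normE ler_piMr// -[leRHS]sqrtr1 ler_wsqrtr//.
  by rewrite /kappa gerBl sqr_ge0.
Unshelve. all: by end_near.
Qed.
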